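(* Let $K\in{}^{*}\mathbb{N}\setminus\mathbb{N}$, let $N=K!$, and let $\Omega=\{\frac{1}{N},\frac{2}{N},\dots,1\}$. Let $P$ be the uniform hyperfinite probability measure on $\Omega$, i.e. $P(\{\omega\})=\frac{1}{N}$ for every $\omega\in\Omega$. Let $$\mathcal{F}=\Big\{\emptyset,\ \Omega,\ \{\tfrac{1}{N},\tfrac{2}{N},\dots,\tfrac{1}{2}\},\ \{\tfrac{1}{2}+\tfrac{1}{N},\dots,1\}\Big\}$$ and let $\mathcal{G}$ be the internal algebra on $\Omega$ generated by the three sets $$\{\tfrac{1}{N},\tfrac{2}{N},\dots,\tfrac{1}{2}-\tfrac{2}{N}\},\quad \{\tfrac{1}{2}-\tfrac{1}{N},\tfrac{1}{2},\tfrac{1}{2}+\tfrac{1}{N}\},\quad \{\tfrac{1}{2}+\tfrac{2}{N},\dots,1\}.$$ Let $\mu$ and $\nu$ be the restrictions of $P$ to $\mathcal{F}$ and $\mathcal{G}$ respectively, and let $\mathcal{M}=(\Omega,\mathcal{F},\mu)$ and $\mathcal{N}=(\Omega,\mathcal{G},\nu)$. Then $\mathcal{N}$ Loeb extends $\mathcal{M}$, but $\mathcal{M}$ is not Loeb equivalent to any internal subspace of $\mathcal{N}$.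
   Context: Work in a nonstandard extension satisfying transfer and (at least countable) saturation. An internal probability space is a triple $(\Omega,\mathcal{F},\mu)$ where $\Omega$ is an internal set, $\mathcal{F}$ is an internal algebra of internal subsets of $\Omega$, and $\mu:\mathcal{F}\to{}^{*}[0,1]$ is an internal finitely additive probability measure. Write $\mathsf{st}$ for the standard part. The Loeb extension of $(\Omega,\mathcal{F},\mu)$ is the countably additive probability space $(\Omega,\overline{\mathcal{F}},\overline{\mu})$, where $\overline{\mathcal{F}}$ consists of all (not necessarily internal) $B\subset\Omega$ with $\sup\{\mathsf{st}(\mu(A)):A\in\mathcal{F},A\subset B\}=\inf\{\mathsf{st}(\mu(C)):C\in\mathcal{F},B\subset C\}$, and $\overline{\mu}(B)$ is this common value. For internal probability spaces $\mathcal{M}=(\Omega,\mathcal{F},\mu)$ and $\mathcal{N}=(\Omega,\mathcal{G},\nu)$: $\mathcal{N}$ Loeb extends $\mathcal{M}$ if $\overline{\mathcal{G}}\supset\overline{\mathcal{F}}$ and $\overline{\nu}$ extends $\overline{\mu}$ as a function; $\mathcal{N}$ is Loeb equivalent to $\mathcal{M}$ if $\overline{\mathcal{F}}=\overline{\mathcal{G}}$ and $\overline{\nu}=\overline{\mu}$. An internal subspace of $\mathcal{N}=(\Omega,\mathcal{G},\nu)$ is an internal probability space $(\Omega,\mathcal{G}',\nu')$ with $\mathcal{G}'\subset\mathcal{G}$ an internal algebra and $\nu'$ the restriction of $\nu$ to $\mathcal{G}'$. *)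

(* Defs.v *)
From mathcomp Require Import all_boot all_order all_algebra.
From mathcomp Require Import all_classical all_reals all_analysis.

Set Implicit Arguments.
Unset Strict Implicit.
Unset Printing Implicit Defensive.

Import Order.TTheory GRing.Theory Num.Theory.

Local Open Scope classical_set_scope.
Local Open Scope ring_scope.

(* Nonstandard extensions are rendered over the hierarchy of all finite types
   above the natural numbers and the reals.  Quantifying over a type of this
   hierarchy plays the role of a quantifier bounded by a set in the
   superstructure presentation. *)
Inductive ty :=
  | tnat
  | treal
  | tprod of ty & ty
  | tpow of ty
  | tarr of ty & ty.

Fixpoint std (R : realType) (t : ty) : Type :=
  match t with
  | tnat => nat
  | treal => R
  | tprod a b => (std R a * std R b)%type
  | tpow a => set (std R a)
  | tarr a b => std R a -> std R b
  end.

Record typed_structure := TypedStructure {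
  dom :> ty -> Type;
  pair_in : forall a b, dom a -> dom b -> dom (tprod a b);
  mem_in : forall a, dom a -> dom (tpow a) -> Prop;
  app_in : forall a b, dom (tarr a b) -> dom a -> dom b
}.

Arguments pair_in S {a b} : rename.
Arguments mem_in S {a} : rename.
Arguments app_in S {a b} : rename.

Definition standard (R : realType) : typed_structure :=
  @TypedStructure (std R)
    (fun a b x y => (x, y)) (fun a x A => A x) (fun a b f x => f x).

(* First-order many-sorted formulas, with typed de Bruijn variables. *)
Inductive var : seq ty -> ty -> Type :=
  | vz c t : var (t :: c) t
  | vs c s t : var c t -> var (s :: c) t.

Inductive term (c : seq ty) : ty -> Type :=
  | tvar t : var c t -> term c t
  | tpair a b : term c a -> term c b -> term c (tprod a b)
  | tapp a b : term c (tarr a b) -> term c a -> term c b.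

Inductive formula : seq ty -> Type :=
  | feq c t : term c t -> term c t -> formula c
  | fmem c t : term c t -> term c (tpow t) -> formula c
  | ffalse c : formula c
  | fconj c : formula c -> formula c -> formula c
  | fdisj c : formula c -> formula c -> formula c
  | fimp c : formula c -> formula c -> formula c
  | fall c t : formula (t :: c) -> formula c
  | fex c t : formula (t :: c) -> formula c.

Fixpoint env (S : ty -> Type) (c : seq ty) : Type :=
  if c is t :: c' then (S t * env S c')%type else unit.

Fixpoint map_env (S S' : ty -> Type) (f : forall t, S t -> S' t)
    (c : seq ty) : env S c -> env S' c :=
  match c with
  | [::] => fun e => e
  | t :: c' => fun e => (f t e.1, map_env f e.2)
  end.

Fixpoint var_val (S : ty -> Type) c t (v : var c t) : env S c -> S t :=
  match v with
  | vz _ _ => fun e => e.1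
  | vs _ _ _ v' => fun e => var_val v' e.2
  end.

Fixpoint term_val (S : typed_structure) c t (u : term c t) (e : env S c) :
    S t :=
  match u with
  | tvar _ v => var_val v e
  | tpair _ _ u1 u2 => pair_in S (term_val u1 e) (term_val u2 e)
  | tapp _ _ u1 u2 => app_in S (term_val u1 e) (term_val u2 e)
  end.

Fixpoint sat (S : typed_structure) c (f : formula c) : env S c -> Prop :=
  match f with
  | feq _ _ u v => fun e => term_val u e = term_val v e
  | fmem _ _ u v => fun e => mem_in S (term_val u e) (term_val v e)
  | ffalse _ => fun _ => False
  | fconj _ g h => fun e => sat g e /\ sat h e
  | fdisj _ g h => fun e => sat g e \/ sat h e
  | fimp _ g h => fun e => sat g e -> sat h e
  | fall _ t g => fun e => forall x : S t, sat (S := S) g (x, e)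
  | fex _ t g => fun e => exists x : S t, sat (S := S) g (x, e)
  end.

(* For a type [t], the elements of [dom U t] are the internal objects of type
   [t]; thus [dom U tnat] is the set of hypernatural numbers, [dom U treal]
   the set of hyperreals, and [dom U (tpow t)] the set of internal subsets of
   [dom U t]. *)
Record nonstandard_extension (R : realType) := NonstandardExtension {
  internal :> typed_structure;
  star : forall t, std R t -> internal t;
  transfer : forall c (f : formula c) (e : env (standard R) c),
    sat f e <-> sat f (map_env star e);
  countable_saturation : forall t (A : nat -> internal (tpow t)),
    (forall n, exists x, forall i, (i <= n)%N -> mem_in internal x (A i)) ->
    exists x, forall i, mem_in internal x (A i)
}.

Section Internal.
Context {R : realType} (U : nonstandard_extension R).

(* The value at [x] of the nonstandard extension of [f]. *)
Definition hmap (a b : ty) (f : std R a -> std R b) : U a -> U b :=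
  app_in U (star U (t := tarr a b) f).

Definition ext t (A : U (tpow t)) : set (U t) := [set x | mem_in U x A].

Definition hreal (r : R) : U treal := star U (t := treal) r.

Definition hadd (x y : U treal) : U treal :=
  @hmap (tprod treal treal) treal (fun p => p.1 + p.2) (pair_in U x y).

Definition hle (x y : U treal) : Prop :=
  mem_in U (pair_in U x y)
    (star U (t := tpow (tprod treal treal)) [set p | p.1 <= p.2]).

Definition hlt (x y : U treal) : Prop :=
  mem_in U (pair_in U x y)
    (star U (t := tpow (tprod treal treal)) [set p | p.1 < p.2]).

(* Equal to 0 if [x] is not finite. *)
Definition st (x : U treal) : R :=
  xget 0 [set r | forall e, 0 < e -> hlt (hreal (r - e)) x
                                  /\ hlt x (hreal (r + e))].

Definition internal_algebra t (Om : U (tpow t)) (F : U (tpow (tpow t))) :=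
  [/\ (forall A, ext F A -> ext A `<=` ext Om),
      ext F Om,
      (forall A, ext F A -> exists2 C, ext F C & ext C = ext Om `\` ext A) &
      (forall A B, ext F A -> ext F B ->
         exists2 C, ext F C & ext C = ext A `|` ext B)].

(* [prob] is an internal function on all internal sets, of which only the
   restriction to [events] is relevant; hence restricting the measure to a
   smaller algebra amounts to keeping [prob] and changing [events]. *)
Record internal_space t := InternalSpace {
  sample : U (tpow t);
  events : U (tpow (tpow t));
  prob : U (tarr (tpow t) treal)
}.

Definition mu t (M : internal_space t) (A : U (tpow t)) : U treal :=
  app_in U (prob M) A.

Definition is_internal_probability_space t (M : internal_space t) :=
  [/\ internal_algebra (sample M) (events M),
      (forall A, ext (events M) A ->
         hle (hreal 0) (mu M A) /\ hle (mu M A) (hreal 1)),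
      mu M (sample M) = hreal 1 &
      (forall A B C, ext (events M) A -> ext (events M) B ->
         ext (events M) C -> ext A `&` ext B = set0 ->
         ext C = ext A `|` ext B -> mu M C = hadd (mu M A) (mu M B))].

Definition loeb_inner t (M : internal_space t) (B : set (U t)) : R :=
  sup [set st (mu M A) | A in [set A | ext (events M) A /\ ext A `<=` B]].

Definition loeb_outer t (M : internal_space t) (B : set (U t)) : R :=
  inf [set st (mu M C) | C in [set C | ext (events M) C /\ B `<=` ext C]].

Definition loeb_algebra t (M : internal_space t) : set (set (U t)) :=
  [set B | B `<=` ext (sample M) /\ loeb_inner M B = loeb_outer M B].

(* Meaningful on [loeb_algebra M] only. *)
Definition loeb_measure t (M : internal_space t) (B : set (U t)) : R :=
  loeb_inner M B.

Definition loeb_extends t (N M : internal_space t) :=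
  [/\ sample N = sample M,
      loeb_algebra M `<=` loeb_algebra N &
      forall B, loeb_algebra M B -> loeb_measure N B = loeb_measure M B].

Definition loeb_equivalent t (N M : internal_space t) :=
  [/\ sample N = sample M,
      loeb_algebra N = loeb_algebra M &
      forall B, loeb_algebra M B -> loeb_measure N B = loeb_measure M B].

Definition internal_subspace t (N' N : internal_space t) :=
  [/\ is_internal_probability_space N',
      sample N' = sample N,
      ext (events N') `<=` ext (events N) &
      forall A, ext (events N') A -> mu N' A = mu N A].

End Internal.

Arguments hmap {R} U a b f.

(* The standard sequences whose extensions at a hypernatural index give the
   internal objects of the example. *)
Section Standard.
Context {R : realType}.

(* The points k/n with 1 <= k <= n lying between [a] and [b]. *)
Definition grid_between (n : nat) (a b : R) : set R :=
  [set x | (exists2 k, (1 <= k <= n)%N & x = k%:R / n%:R) /\ a <= x <= b].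

Definition grid (n : nat) : set R :=
  [set x | exists2 k, (1 <= k <= n)%N & x = k%:R / n%:R].

(* Each point of [grid n] has mass 1/n. *)
Definition uniform (n : nat) (A : set R) : R :=
  \sum_(1 <= k < n.+1) n%:R^-1 * \1_A (k%:R / n%:R).

Definition half_algebra (n : nat) : set (set R) :=
  [set set0; grid n; grid_between n n%:R^-1 2^-1;
   grid_between n (2^-1 + n%:R^-1) 1].

Definition set_algebra T (D : set T) (F : set (set T)) :=
  [/\ (forall A, F A -> A `<=` D), F D, (forall A, F A -> F (D `\` A)) &
      setU_closed F].

(* By transfer, at a hypernatural index this is the least internal algebra
   that contains the three generators. *)
Definition three_block_algebra (n : nat) : set (set R) :=
  smallest (set_algebra (grid n))
    [set grid_between n n%:R^-1 (2^-1 - 2 / n%:R);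
         [set 2^-1 - n%:R^-1; 2^-1; 2^-1 + n%:R^-1];
         grid_between n (2^-1 + 2 / n%:R) 1].

End Standard.

(* Main.v *)
Require Import Defs.
From mathcomp Require Import all_boot all_order all_algebra.
From mathcomp Require Import all_classical all_reals all_analysis.
From mathcomp Require Import ring lra zify.

(** The algebra F of the example has the two halves of the grid as atoms; the
    algebra G has three atoms, the middle one consisting of three points that
    straddle 1/2 and hence of infinitesimal probability.  Adding or removing
    that atom encloses each half between two events of G that have the same
    probability up to an infinitesimal, so G measures in the Loeb sense all
    that F measures ([half_approx], [loeb_extends_approx]).

    The lower half itself is not in G: its last point and the next point of
    the grid both lie in the middle atom, so no event of G separates them
    ([three_block_inseparable]).  An event D of G inside the lower half thus
    omits the last point of the half, and the empty set is the only event of F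
    inside D.  Suppose that F were Loeb equivalent to a subalgebra G' of G.
    Then every D in G' inside the lower half would have as Loeb measure its
    F-inner measure, which is 0, and so the G'-inner measure of the lower half
    would be 0 instead of 1/2 ([not_loeb_equivalent_subspace]).

    Everything about F, G and the uniform probability is proved for a standard
    grid of n points, n even and large, and transferred to n = K!: an infinite
    K lies in the extension of every cofinite set, and k! is even and large for
    all but finitely many k ([mem_star_factorial]).  The formulas to be
    transferred are written with named variables, which a type class translates
    to de Bruijn indices. *)

Set Implicit Arguments.
Unset Strict Implicit.
Unset Printing Implicit Defensive.

Import Order.TTheory GRing.Theory Num.Theory.

Local Open Scope classical_set_scope.
Local Open Scope ring_scope.

(** * Formulas with named variables *)

(** A variable bound in the context [c] has to be used in the longer contexts
    under later binders; instance search finds the number of binders in between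
    from the two contexts. *)
Class suffix (c d : seq ty) := shift : forall t, var c t -> var d t.

#[local] Instance suffix_refl c : suffix c c := fun t v => v.

#[local] Instance suffix_cons s c d (h : suffix c d) : suffix c (s :: d) :=
  fun t v => vs s (h t v).

(** The variable that was added last to [t :: c], seen as a term in every
    extension of that context. *)
Definition name t c := forall d, suffix (t :: c) d -> term d t.

Definition new_name t c : name t c := fun d h => tvar (h t (vz c t)).

Definition named_all t c (f : name t c -> formula (t :: c)) : formula c :=
  fall (f (@new_name t c)).

Definition named_ex t c (f : name t c -> formula (t :: c)) : formula c :=
  fex (f (@new_name t c)).

Fixpoint abstraction (l c : seq ty) : Type :=
  if l is t :: l' then name t c -> abstraction l' (t :: c) else formula c.

(** The variables of [l] remain free; they stand for the constants of a
    transferred statement, and an environment lists their values from last to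
    first. *)
Fixpoint abs (l c : seq ty) : abstraction l c -> formula (catrev l c) :=
  match l with
  | [::] => fun f => f
  | t :: l' => fun f => abs (f (@new_name t c))
  end.

Local Notation "'ALL' x : t , p" := (named_all (fun x : name t _ => p))
  (at level 200, x name, t at level 60, p at level 200, only parsing).
Local Notation "'EX' x : t , p" := (named_ex (fun x : name t _ => p))
  (at level 200, x name, t at level 60, p at level 200, only parsing).
Local Notation "# x" := (x _ _) (at level 1, x at level 0, only parsing).
Local Notation "p 'IMPLIES' q" := (fimp p q)
  (at level 99, right associativity, only parsing).
Local Notation "p 'AND' q" := (fconj p q)
  (at level 80, right associativity, only parsing).
Local Notation "p 'OR' q" := (fdisj p q)
  (at level 85, right associativity, only parsing).
Local Notation "p 'IFF' q" := (fconj (fimp p q) (fimp q p))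
  (at level 99, no associativity, only parsing).
Local Notation "x 'IN' a" := (fmem x a)
  (at level 70, no associativity, only parsing).
Local Notation "x 'EQ' y" := (feq x y)
  (at level 70, no associativity, only parsing).

Local Notation tset := (tpow treal).
Local Notation tfamily := (tpow (tpow treal)).
Local Notation tmeasure := (tarr (tpow treal) treal).
Local Notation trelation := (tpow (tprod treal treal)).
Local Notation toperation := (tarr (tprod treal treal) treal).

(** On an explicit formula, [sat] unfolds by conversion to the statement that
    the formula expresses, so this lemma applies to such statements directly. *)
Lemma transferred (R : realType) (U : nonstandard_extension R) c
    (f : formula c) (e : env (standard R) c) :
  sat f e -> sat f (map_env (star U) e).
Proof. exact: (transfer U f e).1. Qed.

Arguments transferred {R} U {c} f e _.

(** * Order and standard parts of hyperreals *)

Section Order.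
Context {R : realType} (U : nonstandard_extension R).
Implicit Types (x y z : U treal) (r s e : R).

Let le : set (R * R) := [set p | p.1 <= p.2].
Let lt : set (R * R) := [set p | p.1 < p.2].
Let add : R * R -> R := fun p => p.1 + p.2.

Lemma hlt_hreal r s : r < s -> hlt (hreal U r) (hreal U s).
Proof.
move=> rs; refine (transferred U (abs
  (l := [:: trelation; treal; treal]) (c := [::])
  (fun lt a b => tpair #a #b IN #lt)) (s, (r, (lt, tt))) rs).
Qed.

Lemma hle_hreal r s : r <= s -> hle (hreal U r) (hreal U s).
Proof.
move=> rs; refine (transferred U (abs
  (l := [:: trelation; treal; treal]) (c := [::])
  (fun le a b => tpair #a #b IN #le)) (s, (r, (le, tt))) rs).
Qed.

Lemma hlt_irrefl x : ~ hlt x x.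
Proof.
move: x; refine (transferred U (abs
  (l := [:: trelation]) (c := [::])
  (fun lt => ALL x : treal, (tpair #x #x IN #lt) IMPLIES (ffalse _)))
  (lt, tt) _).
by move=> a; rewrite /= /lt /= ltxx.
Qed.

Lemma hlt_le_trans x y z : hlt x y -> hle y z -> hlt x z.
Proof.
move: x y z; refine (transferred U (abs
  (l := [:: trelation; trelation]) (c := [::])
  (fun le lt => ALL x : treal, ALL y : treal, ALL z : treal,
     (tpair #x #y IN #lt) IMPLIES (tpair #y #z IN #le)
     IMPLIES (tpair #x #z IN #lt)))
  (lt, (le, tt)) _).
move=> a b c; exact: lt_le_trans.
Qed.

Lemma hle_lt_trans x y z : hle x y -> hlt y z -> hlt x z.
Proof.
move: x y z; refine (transferred U (abs
  (l := [:: trelation; trelation]) (c := [::])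
  (fun le lt => ALL x : treal, ALL y : treal, ALL z : treal,
     (tpair #x #y IN #le) IMPLIES (tpair #y #z IN #lt)
     IMPLIES (tpair #x #z IN #lt)))
  (lt, (le, tt)) _).
move=> a b c; exact: le_lt_trans.
Qed.

Lemma hltW x y : hlt x y -> hle x y.
Proof.
move: x y; refine (transferred U (abs
  (l := [:: trelation; trelation]) (c := [::])
  (fun le lt => ALL x : treal, ALL y : treal,
     (tpair #x #y IN #lt) IMPLIES (tpair #x #y IN #le)))
  (lt, (le, tt)) _).
move=> a b; exact: ltW.
Qed.

Lemma hle_or_hlt x y : hle x y \/ hlt y x.
Proof.
move: x y; refine (transferred U (abs
  (l := [:: trelation; trelation]) (c := [::])
  (fun le lt => ALL x : treal, ALL y : treal,
     (tpair #x #y IN #le) OR (tpair #y #x IN #lt)))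
  (lt, (le, tt)) _).
move=> a b; case: (leP a b) => ab; [left|right]; exact: ab.
Qed.

Lemma hle_haddr x y : hle (hreal U 0) y -> hle x (hadd x y).
Proof.
move: x y; refine (transferred U (abs
  (l := [:: trelation; toperation; treal]) (c := [::])
  (fun le add zero => ALL x : treal, ALL y : treal, (tpair #zero #y IN #le)
     IMPLIES (tpair #x (tapp #add (tpair #x #y)) IN #le)))
  (0, (add, (le, tt))) _).
by move=> a b b0; rewrite /= /le /= /add /= lerDl.
Qed.

Lemma hle_hadd0 x y : hle x y -> hle x (hadd y (hreal U 0)).
Proof.
move: x y; refine (transferred U (abs
  (l := [:: trelation; toperation; treal]) (c := [::])
  (fun le add zero => ALL x : treal, ALL y : treal, (tpair #x #y IN #le)
     IMPLIES (tpair #x (tapp #add (tpair #y #zero)) IN #le)))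
  (0, (add, (le, tt))) _).
by move=> a b; rewrite /= /le /= /add /= addr0.
Qed.

(** Turns a standard bound of [x] into a standard bound of [y]: the sum
    [r + e] is taken in the standard reals. *)
Lemma hlt_shift x y r e :
  hle y (hadd x (hreal U e)) -> hlt x (hreal U r) -> hlt y (hreal U (r + e)).
Proof.
move: x y; refine (transferred U (abs
  (l := [:: trelation; trelation; toperation; treal; treal; treal])
  (c := [::])
  (fun le lt add a d ad => ALL x : treal, ALL y : treal,
     (tpair #y (tapp #add (tpair #x #d)) IN #le) IMPLIES
     (tpair #x #a IN #lt) IMPLIES (tpair #y #ad IN #lt)))
  (r + e, (e, (r, (add, (lt, (le, tt)))))) _).
move=> b c; rewrite /= /le /lt /add /=; lra.
Qed.

Definition infinitely_close_to x r := forall e, 0 < e ->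
  hlt (hreal U (r - e)) x /\ hlt x (hreal U (r + e)).

Lemma infinitely_close_shift x y r s e : infinitely_close_to x r ->
  infinitely_close_to y s -> hle y (hadd x (hreal U e)) -> s <= r + e.
Proof.
move=> xr ys yx; rewrite leNgt; apply/negP => lt_s.
have d0 : 0 < (s - (r + e)) / 2 by rewrite divr_gt0 ?subr_gt0.
have [_ /(hlt_shift yx) y_lt] := xr _ d0.
have [lt_y _] := ys _ d0.
apply: (@hlt_irrefl y); apply: hlt_le_trans y_lt _.
apply: hltW; apply: hle_lt_trans lt_y.
by apply: hle_hreal; lra.
Qed.

Lemma infinitely_close_unique x r s :
  infinitely_close_to x r -> infinitely_close_to x s -> r = s.
Proof.
have xx : hle x (hadd x (hreal U 0)) by exact: hle_haddr (hle_hreal (lexx 0)).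
move=> xr xs; apply/le_anti/andP; split.
  by rewrite -[s]addr0; apply: infinitely_close_shift xs xr xx.
by rewrite -[r]addr0; apply: infinitely_close_shift xr xs xx.
Qed.

Lemma st_unique x r : infinitely_close_to x r -> st x = r.
Proof.
move=> xr; apply: xget_unique => // s xs.
exact: infinitely_close_unique xs xr.
Qed.

Lemma st_hreal r : st (hreal U r) = r.
Proof.
apply: st_unique => e e0; split; apply: hlt_hreal.
  by rewrite ltrBlDr ltrDl.
by rewrite ltrDl.
Qed.

Definition in_hunit x := hle (hreal U 0) x /\ hle x (hreal U 1).

(** The standard part of [x] is the supremum of the standard reals below [x],
    so this is where the completeness of the reals enters. *)
Lemma stP x : in_hunit x -> infinitely_close_to x (st x).
Proof.
move=> [x0 x1]; pose below := [set q : R | hle (hreal U q) x].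
have below1 q : below q -> q <= 1.
  move=> qx; rewrite leNgt; apply/negP => /hlt_hreal q1.
  apply: (@hlt_irrefl x); apply: hle_lt_trans x1 _.
  exact: hlt_le_trans q1 qx.
have sup_below : has_sup below.
  by split; [exists 0 | exists 1 => q; exact: below1].
suff close : infinitely_close_to x (sup below) by rewrite (st_unique close).
move=> e e0; split.
  have [q qx q_gt] := sup_adherent e0 sup_below.
  exact: hlt_le_trans (hlt_hreal q_gt) qx.
have [le_x|//] := hle_or_hlt (hreal U (sup below + e)) x.
have := ub_le_sup (proj2 sup_below) le_x.
by rewrite leNgt ltrDl e0.
Qed.

Lemma st_le_shift x y e : in_hunit x -> in_hunit y ->
  hle y (hadd x (hreal U e)) -> st y <= st x + e.
Proof. by move=> /stP xs /stP ys; exact: infinitely_close_shift. Qed.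

Lemma st_le x y : in_hunit x -> in_hunit y -> hle x y -> st x <= st y.
Proof.
by move=> xu yu xy; rewrite -[st y]addr0 st_le_shift//; exact: hle_hadd0.
Qed.

Lemma in_hunit_hreal r : 0 <= r <= 1 -> in_hunit (hreal U r).
Proof. by move=> /andP[r0 r1]; split; exact: hle_hreal. Qed.

Lemma st_ge0 x : in_hunit x -> 0 <= st x.
Proof.
move=> xu; rewrite -(st_hreal 0) st_le//; last by case: xu.
by apply: in_hunit_hreal; rewrite lexx ler01.
Qed.

Lemma st_le1 x : in_hunit x -> st x <= 1.
Proof.
move=> xu; rewrite -[leRHS]st_hreal st_le//; last by case: xu.
by apply: in_hunit_hreal; rewrite lexx ler01.
Qed.

End Order.

(** * Loeb measures *)

Section Loeb.
Context {R : realType} (U : nonstandard_extension R) (t : ty).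
Implicit Types (M N : internal_space U t) (A C : U (tpow t)) (B : set (U t)).

Lemma in_hunit_mu M A : is_internal_probability_space M ->
  ext (events M) A -> in_hunit (mu M A).
Proof. by move=> [_ h _ _] /h. Qed.

(** An internal algebra has differences only up to extension: [C `\` A] is
    obtained as the complement of the union of [A] and the complement of
    [C]. *)
Lemma mu_le M A C : is_internal_probability_space M -> ext (events M) A ->
  ext (events M) C -> ext A `<=` ext C -> hle (mu M A) (mu M C).
Proof.
move=> [[sub Om compl union] unit _ add] MA MC AC.
have [C' MC' C'E] := compl _ MC; have [D' MD' D'E] := union _ _ MA MC'.
have [D MD DE] := compl _ MD'.
have {}DE : ext D = ext C `\` ext A.
  rewrite DE D'E C'E; apply/seteqP; split=> x /=.
    move=> [Omx nx]; split; last by move=> Ax; apply: nx; left.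
    by apply: contrapT => Cx; apply: nx; right.
  move=> [Cx nAx]; split; first exact: sub Cx.
  by move=> [//|[_]]; exact.
rewrite (add A D C)//; first by apply: hle_haddr; exact: (unit _ MD).1.
  by rewrite DE setDIK.
by rewrite DE setDUK.
Qed.

Lemma exists_empty_event M : is_internal_probability_space M ->
  exists2 A, ext (events M) A & ext A = set0.
Proof.
move=> [[_ Om compl _] _ _ _]; have [A MA AE] := compl _ Om.
by exists A => //; rewrite AE setDv.
Qed.

Section OneSpace.
Variable M : internal_space U t.
Hypothesis prob_M : is_internal_probability_space M.

Let inner_set B :=
  [set st (mu M A) | A in [set A | ext (events M) A /\ ext A `<=` B]].
Let outer_set B :=
  [set st (mu M C) | C in [set C | ext (events M) C /\ B `<=` ext C]].

Let inner_set_sup B : has_sup (inner_set B).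
Proof.
split; last by exists 1 => _ [A [MA _] <-]; exact/st_le1/in_hunit_mu.
have [A MA AE] := exists_empty_event prob_M.
by exists (st (mu M A)), A => //; split=> //; rewrite AE.
Qed.

Lemma st_mu_le_loeb_inner A B : ext (events M) A -> ext A `<=` B ->
  st (mu M A) <= loeb_inner M B.
Proof. by move=> MA AB; apply: (ub_le_sup (inner_set_sup B).2); exists A. Qed.

Lemma loeb_inner_le B r :
  (forall A, ext (events M) A -> ext A `<=` B -> st (mu M A) <= r) ->
  loeb_inner M B <= r.
Proof.
move=> le_r; apply: ge_sup; first by case: (inner_set_sup B).
by move=> _ [A [MA AB] <-]; exact: le_r.
Qed.

Lemma loeb_outer_le_st_mu C B : ext (events M) C -> B `<=` ext C ->
  loeb_outer M B <= st (mu M C).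
Proof.
move=> MC BC; apply: ge_inf; last by exists C.
by exists 0 => _ [A [MA _] <-]; exact/st_ge0/in_hunit_mu.
Qed.

Lemma le_loeb_outer B r : B `<=` ext (sample M) ->
  (forall C, ext (events M) C -> B `<=` ext C -> r <= st (mu M C)) ->
  r <= loeb_outer M B.
Proof.
move=> BM ge_r; apply: lb_le_inf; last by move=> _ [C [MC BC] <-]; exact: ge_r.
have [[_ Om _ _] _ _ _] := prob_M.
by exists (st (mu M (sample M))), (sample M).
Qed.

Lemma loeb_inner_le_outer B : B `<=` ext (sample M) ->
  loeb_inner M B <= loeb_outer M B.
Proof.
move=> BM; apply: loeb_inner_le => A MA AB; apply: le_loeb_outer => // C MC BC.
apply: st_le; do ?exact: in_hunit_mu.
by apply: mu_le => //; exact: subset_trans BC.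
Qed.

Lemma loeb_inner_event A : ext (events M) A ->
  loeb_inner M (ext A) = st (mu M A).
Proof.
move=> MA; apply/le_anti/andP; split; last exact: st_mu_le_loeb_inner.
apply: loeb_inner_le => C MC CA.
by apply: st_le; do ?exact: in_hunit_mu; exact: mu_le.
Qed.

Lemma loeb_algebra_event A : ext (events M) A -> loeb_algebra M (ext A).
Proof.
move=> MA; have [[sub _ _ _] _ _ _] := prob_M.
split; first exact: sub.
apply/le_anti/andP; split; first exact/loeb_inner_le_outer/sub.
by rewrite loeb_inner_event//; exact: loeb_outer_le_st_mu.
Qed.

End OneSpace.

(** Approximation from inside gives that inner measures grow from [M] to [N],
    approximation from outside that outer measures shrink; a set on which
    the two agree in [M] is squeezed. *)
Lemma loeb_extends_approx M N :
  is_internal_probability_space M -> is_internal_probability_space N ->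
  sample N = sample M ->
  (forall e, 0 < e -> forall A, ext (events M) A ->
     exists C D, [/\ ext (events N) C, ext (events N) D,
       ext C `<=` ext A, ext A `<=` ext D &
       hle (mu M A) (hadd (mu N C) (hreal U e)) /\
       hle (mu N D) (hadd (mu M A) (hreal U e))]) ->
  loeb_extends N M.
Proof.
move=> prob_M prob_N sampleE approx.
have inner_le B : loeb_inner M B <= loeb_inner N B.
  apply: loeb_inner_le => // A MA AB; apply/ler_addgt0Pr => e e0.
  have [C [D [NC _ CA _ [le_C _]]]] := approx _ e0 _ MA.
  apply: le_trans (st_le_shift _ _ le_C) _; do ?exact: in_hunit_mu.
  by rewrite lerD2r st_mu_le_loeb_inner//; exact: subset_trans AB.
have outer_le B : B `<=` ext (sample M) -> loeb_outer N B <= loeb_outer M B.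
  move=> BM; apply: le_loeb_outer => // A MA BA; apply/ler_addgt0Pr => e e0.
  have [C [D [_ ND _ AD [_ le_D]]]] := approx _ e0 _ MA.
  apply: le_trans (st_le_shift _ _ le_D); do ?exact: in_hunit_mu.
  by apply: loeb_outer_le_st_mu => //; exact: subset_trans AD.
have innerE B : loeb_algebra M B ->
    loeb_inner N B = loeb_inner M B /\ loeb_outer N B = loeb_inner M B.
  move=> [BM MB].
  have NB : loeb_inner N B <= loeb_outer N B.
    by apply: loeb_inner_le_outer => //; rewrite sampleE.
  have := outer_le _ BM; rewrite -MB => le_M.
  split; apply/le_anti; rewrite ?inner_le ?le_M ?andbT//=.
    exact: le_trans le_M.
  exact: le_trans NB.
split=> // [B MB|B /innerE[]//].
have [iE oE] := innerE _ MB; split; last by rewrite iE oE.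
by rewrite sampleE; case: MB.
Qed.

(** An event of [N'] inside [A] is Loeb measurable in [N'], hence in [M], with
    the same measure.  By hypothesis its inner measure in [M] vanishes, so the
    inner measure of [A] in [N'] is 0, whereas it has to be [st (mu M A)]. *)
Lemma not_loeb_equivalent_subspace M N A :
  is_internal_probability_space M -> is_internal_probability_space N ->
  ext (events M) A -> 0 < st (mu M A) ->
  (forall D, ext (events N) D -> ext D `<=` ext A ->
     forall C, ext (events M) C -> ext C `<=` ext D ->
     hle (mu M C) (hreal U 0)) ->
  ~ exists2 N', internal_subspace N' N & loeb_equivalent M N'.
Proof.
move=> prob_M prob_N MA A0 no_event [N' [prob_N' _ sub muE] [_ algE measE]].
have := loeb_algebra_event prob_M MA; rewrite algE => N'A.
have := measE _ N'A; rewrite /loeb_measure loeb_inner_event// => AE.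
suff : loeb_inner N' (ext A) <= 0 by rewrite -AE leNgt A0.
apply: loeb_inner_le => // D N'D DA.
rewrite -loeb_inner_event// -[leLHS]measE; last exact: loeb_algebra_event.
apply: loeb_inner_le => // C MC CD; rewrite -[leRHS](st_hreal U).
apply: st_le; first exact: in_hunit_mu.
  by apply: in_hunit_hreal; rewrite lexx ler01.
by apply: no_event CD => //; exact: sub.
Qed.

End Loeb.

(** * Uniform probability on a standard grid *)

Section Uniform.
Context {R : realType}.
Implicit Types (A B : set R) (n i j k : nat).

Lemma uniform_ge0 n A : 0 <= uniform n A.
Proof. by apply: sumr_ge0 => k _; rewrite mulr_ge0// ?invr_ge0. Qed.

Lemma uniform_setU n A B : A `&` B = set0 ->
  uniform n (A `|` B) = uniform n A + uniform n B.
Proof.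
move=> AB; rewrite /uniform -big_split/=; apply: eq_bigr => k _.
rewrite -mulrDr; congr (_ * _); rewrite !indicE in_setU.
have [kA|] := boolP (_ \in A); have [kB|] := boolP (_ \in B);
  rewrite /= ?addr0 ?add0r//.
have : (A `&` B) (k%:R / n%:R) by split; exact: set_mem.
by rewrite AB.
Qed.

(** All sets of the example are intervals of grid points; integer bounds make
    their boolean algebra and their probabilities decidable by [lia]. *)
Definition block n i j : set R :=
  [set x | exists2 k, (i <= k <= j)%N & x = k%:R / n%:R].

Lemma gridE n : grid n = block n 1 n.
Proof. by []. Qed.

Lemma blockP n i j k : (0 < n)%N ->
  block n i j (k%:R / n%:R) <-> (i <= k <= j)%N.
Proof.
move=> n0; split=> [[l lij /mulIf]|kij]; last by exists k.
by rewrite invr_eq0 pnatr_eq0 -lt0n => /(_ n0)/eqP; rewrite eqr_nat => /eqP->.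
Qed.

Lemma grid_betweenE n i j : (0 < n)%N -> (0 < i)%N -> (j <= n)%N ->
  grid_between n (i%:R / n%:R) (j%:R / n%:R) = block n i j.
Proof.
move=> n0 i0 jn; have np : 0 < n%:R^-1 :> R by rewrite invr_gt0 ltr0n.
apply/seteqP; split=> [_ [[k _ ->]]|_ [k /andP[ik kj] ->]].
  by rewrite !ler_pM2r// !ler_nat => ikj; exists k.
split; last by rewrite !ler_pM2r// !ler_nat ik.
by exists k => //; rewrite (leq_trans i0 ik) (leq_trans kj).
Qed.

Lemma block_setU n i j k : (i <= j.+1)%N -> (j <= k)%N ->
  block n i j `|` block n j.+1 k = block n i k.
Proof.
move=> ij jk; apply/seteqP; split=> [_ [|] [l lij ->]|_ [l lik ->]].
- by exists l => //; lia.
- by exists l => //; lia.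
- by have [lj|jl] := leqP l j; [left|right]; exists l => //; lia.
Qed.

Lemma uniform_block n i j : (0 < n)%N -> (0 < i)%N -> (j <= n)%N ->
  uniform n (block n i j) = (j.+1 - i)%:R / n%:R.
Proof.
move=> n0 i0 jn; rewrite /uniform.
transitivity (\sum_(1 <= k < n.+1 | (i <= k < j.+1)%N) (n%:R^-1 : R)).
  rewrite [RHS]big_mkcond/=; apply: eq_bigr => k _; rewrite indicE.
  have -> : (k%:R / n%:R \in block n i j) = (i <= k < j.+1)%N.
    apply/idP/idP => [/set_mem/(blockP _ _ _ n0)//|ikj].
    exact/mem_set/blockP.
  by case: ifP; rewrite ?mulr1 ?mulr0.
transitivity (\sum_(i <= k < j.+1) (n%:R^-1 : R)).
  rewrite [RHS](big_nat_widen _ _ n.+1)// [RHS](big_nat_widenl _ 1)//.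
  by apply: eq_bigl => k /=; rewrite andbC.
by rewrite sumr_const_nat -[LHS]mulr_natl.
Qed.

Lemma uniform_set0 n : uniform n (set0 : set R) = 0.
Proof. by apply: big1 => k _; rewrite indic0 mulr0. Qed.

Lemma uniform_le n A B : A `<=` B -> uniform n A <= uniform n B.
Proof.
move=> AB; rewrite -(setDUK AB) uniform_setU ?lerDl ?uniform_ge0//.
exact: setDIK.
Qed.

Lemma uniform_grid n : (0 < n)%N -> uniform n (grid n) = 1 :> R.
Proof.
move=> n0; rewrite gridE uniform_block// subSS subn0 divff//.
by rewrite pnatr_eq0 -lt0n.
Qed.

End Uniform.

(** * Algebras of sets *)

Section Sets.
Context {T : Type}.
Implicit Types (D A B L : set T) (F : set (set T)).

Lemma set_algebra_pair D L : L `<=` D ->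
  set_algebra D [set set0; D; L; D `\` L].
Proof.
move=> LD; split.
- by move=> A [[[]|]|] ->.
- by left; left; right.
- move=> A [[[]|]|] ->.
  + by left; left; right; rewrite setD0.
  + by left; left; left; rewrite setDv.
  + by right.
  + by left; right; rewrite setDD setIidr.
- move=> A B FA FB.
  have LC : L `|` (D `\` L) = D by rewrite setDUK.
  have absorb C : C `<=` D -> (D `|` C = D) * (C `|` D = D).
    by move=> CD; rewrite [C `|` D]setUC; split; exact/setUidPl.
  have DL := absorb _ LD; have DC := absorb _ (@subDsetl _ D L).
  case: FA => [[[]|]|] ->; case: FB => [[[]|]|] ->;
    rewrite ?set0U ?setU0 ?setUid ?LC ?DL ?DC ?[(_ `\` _) `|` L]setUC ?LC /=;
    tauto.
Qed.

(** The subsets of [D] form an algebra that contains the generators; it keeps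
    the generated algebra inside [D]. *)
Lemma set_algebra_smallest D F : (forall A, F A -> A `<=` D) ->
  set_algebra D (smallest (set_algebra D) F).
Proof.
move=> FD.
have alg_sub : set_algebra D [set A | A `<=` D].
  by split=> //= A B AD BD; rewrite /= subUset.
split.
- by move=> A GA; exact: (GA _ (conj alg_sub FD)).
- by move=> G [[]].
- by move=> A GA G algF; have [[_ _ GD _] _] := algF; exact: GD (GA _ algF).
- move=> A B GA GB G algF; have [[_ _ _ GU] _] := algF.
  by apply: GU; [exact: GA|exact: GB].
Qed.

(** Not separating [p] from [q] is thus an invariant of generated algebras. *)
Lemma set_algebra_inseparable D (p q : T) : D p -> D q ->
  set_algebra D [set A | A `<=` D /\ (A p <-> A q)].
Proof.
move=> Dp Dq; split=> /=.
- by move=> A [].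
- by split.
- by move=> A [_ Apq]; split; [exact: subDsetl|split=> -[_ nA]; split; tauto].
- move=> A B [AD Apq] [BD Bpq]; split; first by rewrite subUset.
  by split=> -[] ?; [left|right|left|right]; tauto.
Qed.

End Sets.

(** * The half algebra and the three-block algebra *)

Section Algebras.
Context {R : realType} (m : nat).
Hypothesis m_ge2 : (2 <= m)%N.
Let n := m.*2.
Implicit Types (A C D : set R) (i j k : nat).

Let n_gt0 : (0 < n)%N. Proof. by rewrite /n; lia. Qed.

Let halfE : 2^-1 = m%:R / n%:R :> R.
Proof. by rewrite /n -muln2 natrM; field; rewrite pnatr_eq0; lia. Qed.

Let half_addE i : 2^-1 + i%:R / n%:R = (m + i)%:R / n%:R :> R.
Proof. by rewrite halfE -mulrDl -natrD. Qed.

Let half_subE j : (j <= m)%N -> 2^-1 - j%:R / n%:R = (m - j)%:R / n%:R :> R.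
Proof. by move=> jm; rewrite halfE -mulrBl -natrB. Qed.

Let firstE : n%:R^-1 = 1%:R / n%:R :> R. Proof. by rewrite div1r. Qed.
Let lastE : 1 = n%:R / n%:R :> R.
Proof. by rewrite divff// pnatr_eq0 -lt0n. Qed.

Lemma lower_halfE : grid_between n (n%:R^-1) 2^-1 = block n 1 m :> set R.
Proof. by rewrite firstE halfE grid_betweenE// /n; lia. Qed.

Lemma upper_halfE :
  grid_between n (2^-1 + n%:R^-1) 1 = block n m.+1 n :> set R.
Proof.
by rewrite firstE half_addE [X in grid_between _ _ X]lastE addn1 grid_betweenE.
Qed.

Lemma lower_blockE :
  grid_between n (n%:R^-1) (2^-1 - 2 / n%:R) = block n 1 (m - 2) :> set R.
Proof.
rewrite [X in grid_between _ X _]firstE half_subE//.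
by rewrite grid_betweenE// /n; lia.
Qed.

Lemma upper_blockE :
  grid_between n (2^-1 + 2 / n%:R) 1 = block n m.+2 n :> set R.
Proof.
by rewrite half_addE [X in grid_between _ _ X]lastE addn2 grid_betweenE.
Qed.

Lemma middle_blockE :
  [set 2^-1 - n%:R^-1; 2^-1; 2^-1 + n%:R^-1] = block n m.-1 m.+1 :> set R.
Proof.
rewrite firstE half_subE ?half_addE ?halfE; last lia.
apply/seteqP; split=> [x [[]|] ->|_ [k km ->] /=].
- by exists (m - 1)%N => //; lia.
- by exists m => //; lia.
- by exists (m + 1)%N => //; lia.
have [->|[->|->]] : k = (m - 1)%N \/ k = m \/ k = (m + 1)%N by lia.
- by left; left.
- by left; right.
- by right.
Qed.

Lemma block_sub i j k l : (k <= i)%N -> (j <= l)%N ->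
  block n i j `<=` (block n k l : set R).
Proof. by move=> ki jl x [p pij ->]; exists p => //; lia. Qed.

Lemma half_algebraE : half_algebra n =
  [set set0; grid n; block n 1 m; grid n `\` block n 1 m] :> set (set R).
Proof.
rewrite /half_algebra lower_halfE upper_halfE; congr (_ `|` [set _]).
apply/seteqP; split=> [_ [k km ->]|_ [[k kn ->] nk]].
  by split; [exists k => //; lia|rewrite blockP//; lia].
exists k => //; have [km|mk] := leqP k m; last lia.
by exfalso; apply: nk; exists k => //; lia.
Qed.

Lemma set_algebra_half : set_algebra (grid n) (half_algebra n : set (set R)).
Proof.
rewrite half_algebraE; apply: set_algebra_pair.
by apply: block_sub; rewrite /n; lia.
Qed.

Lemma three_block_algebraE : three_block_algebra n =
  smallest (set_algebra (grid n))
    [set block n 1 (m - 2); block n m.-1 m.+1; block n m.+2 n] :> set (set R).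
Proof.
by rewrite /three_block_algebra lower_blockE middle_blockE upper_blockE.
Qed.

Let generators_sub A :
  [set block n 1 (m - 2); block n m.-1 m.+1; block n m.+2 n] A ->
  A `<=` grid n.
Proof. by move=> [[]|] ->; apply: block_sub; rewrite /n; lia. Qed.

Lemma set_algebra_three_block :
  set_algebra (grid n) (three_block_algebra n : set (set R)).
Proof.
rewrite three_block_algebraE; apply: set_algebra_smallest.
exact: generators_sub.
Qed.

(** The two points next to the cut both lie in the middle generator and in
    neither of the outer ones. *)
Lemma three_block_inseparable A : three_block_algebra n A ->
  A (m%:R / n%:R) <-> A (m.+1%:R / n%:R).
Proof.
rewrite three_block_algebraE => GA.
suff [] : [set C : set R | C `<=` grid n /\
  (C (m%:R / n%:R) <-> C (m.+1%:R / n%:R))] A by [].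
apply: GA; split.
  by apply: set_algebra_inseparable; rewrite gridE blockP// /n; lia.
move=> B genB; split; first exact: generators_sub.
by case: genB => [[]|] ->; rewrite !blockP//; lia.
Qed.

End Algebras.

Section Approximation.
Context {R : realType}.
Implicit Types (A : set R).

(** A half is enclosed between the outer block that it contains and the union
    of this block with the middle one.  The middle block has two points in the
    lower half and one in the upper half, so each inclusion misses at most two
    points, of total probability 2/n. *)
Lemma half_approx m e A : (2 <= m)%N -> 2 / m.*2%:R <= e ->
  half_algebra m.*2 A -> exists C D : set R,
    [/\ three_block_algebra m.*2 C, three_block_algebra m.*2 D,
        C `<=` A, A `<=` D &
        uniform m.*2 A <= uniform m.*2 C + e /\
        uniform m.*2 D <= uniform m.*2 A + e].
Proof.
move=> m2 e_ge HA; set n := m.*2.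
have n0 : 0 < n%:R :> R by rewrite ltr0n /n; lia.
have n_gt0 : (0 < n)%N by rewrite /n; lia.
have e0 : 0 <= e by apply: le_trans e_ge; rewrite divr_ge0// ltW.
have [sub GOm GD GU] := @set_algebra_three_block R m m2.
have self C : three_block_algebra n C -> A = C -> exists C D : set R,
    [/\ three_block_algebra n C, three_block_algebra n D,
        C `<=` A, A `<=` D &
        uniform n A <= uniform n C + e /\ uniform n D <= uniform n A + e].
  by move=> GC ->; exists C, C; split=> //; rewrite lerDl.
have gen i j : [set block n 1 (m - 2); block n m.-1 m.+1; block n m.+2 n]
    (block n i j : set R) -> three_block_algebra n (block n i j : set R).
  by move=> genB; rewrite three_block_algebraE// => G [_]; exact.
have lower := gen 1%N (m - 2)%N (or_introl (or_introl erefl)).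
have middle := gen m.-1 m.+1 (or_introl (or_intror erefl)).
have upper := gen m.+2 n (or_intror erefl).
have close i j : (j%:R <= i%:R + 2 :> R) -> j%:R / n%:R <= i%:R / n%:R + e.
  move=> ij; apply: le_trans (_ : i%:R / n%:R + 2 / n%:R <= _).
    by rewrite -mulrDl ler_pM2r// invr_gt0.
  by rewrite lerD2l.
case: HA => [[[]|]|] AE.
- by apply: (self (grid n `\` grid n)); [exact: GD|rewrite setDv].
- exact: self AE.
- rewrite AE lower_halfE// -/n; exists (block n 1 (m - 2)), (block n 1 m.+1).
  split=> //.
  + rewrite -(@block_setU _ n 1 (m - 2) m.+1)//; last lia.
    apply: (GU) => //; have -> : (m - 2).+1 = m.-1 by lia.
    exact: middle.
  + by apply: block_sub; lia.
  + by apply: block_sub; lia.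
  + rewrite !uniform_block//; do ?by rewrite /n; lia.
    by split; apply: close; rewrite -[X in _ + X]/(2%:R) -natrD ler_nat; lia.
- rewrite AE upper_halfE// -/n; exists (block n m.+2 n), (block n m.-1 n).
  split=> //.
  + rewrite -(@block_setU _ n m.-1 m.+1 n)//; [exact: GU|lia|rewrite /n; lia].
  + by apply: block_sub; lia.
  + by apply: block_sub; lia.
  + rewrite !uniform_block//; do ?by rewrite /n; lia.
    split; apply: close; rewrite -[X in _ + X]/(2%:R) -natrD ler_nat /n; lia.
Qed.

(** A witness [D] contains neither [m/n] nor [(m+1)/n], while every nonempty
    event of the half algebra contains one of these two points. *)
Lemma lower_half_not_approx m : (2 <= m)%N -> exists A : set R,
  [/\ half_algebra m.*2 A, 2^-1 <= uniform m.*2 A &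
      forall D, three_block_algebra m.*2 D -> D `<=` A ->
      forall C, half_algebra m.*2 C -> C `<=` D -> uniform m.*2 C <= 0].
Proof.
move=> m2; set n := m.*2; have n_gt0 : (0 < n)%N by rewrite /n; lia.
exists (block n 1 m); split.
- by rewrite half_algebraE//; left; right.
- rewrite uniform_block ?subn1//; last by rewrite /n; lia.
  by rewrite /n -muln2 natrM invfM mulrA divff ?mul1r// pnatr_eq0; lia.
(* [D] omits the first point of the upper half, hence its neighbour too. *)
move=> D GD DA C HC CD; have D_sep := three_block_inseparable m2 GD.
have nD : ~ D (m.+1%:R / n%:R) by move=> /DA; rewrite blockP//; lia.
have nD' : ~ D (m%:R / n%:R) by rewrite D_sep.
have nC k : (k == m) || (k == m.+1) -> ~ C (k%:R / n%:R).
  by move=> /orP[] /eqP-> /CD.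
case: HC => [[[]|]|] CE.
- by rewrite CE uniform_set0.
- by case: (nC m); rewrite ?eqxx// CE gridE blockP// /n; lia.
- by case: (nC m); rewrite ?eqxx// CE lower_halfE// blockP//; lia.
- by case: (nC m.+1); rewrite ?eqxx ?orbT// CE upper_halfE// blockP// /n; lia.
Qed.

End Approximation.

(** * Transfer to a factorial of an infinite number *)

(** The clauses follow those of [is_internal_probability_space], with equality
    of extensions spelled out pointwise. *)
Definition space_formula := abs (l := [:: tpow tnat; tarr tnat tset;
    tarr tnat tfamily; tarr tnat tmeasure; treal; treal; trelation;
    toperation]) (c := [::])
  (fun good Om F P zero one le add => ALL n : tnat, #n IN #good IMPLIES
    ((ALL A : tset, #A IN tapp #F #n IMPLIES
        ALL x : treal, #x IN #A IMPLIES #x IN tapp #Om #n) AND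
     tapp #Om #n IN tapp #F #n AND
     (ALL A : tset, #A IN tapp #F #n IMPLIES
        EX C : tset, #C IN tapp #F #n AND
        ALL x : treal, #x IN #C IFF
          (#x IN tapp #Om #n AND (#x IN #A IMPLIES ffalse _))) AND
     (ALL A : tset, ALL B : tset,
        #A IN tapp #F #n IMPLIES #B IN tapp #F #n IMPLIES
        EX C : tset, #C IN tapp #F #n AND
        ALL x : treal, #x IN #C IFF (#x IN #A OR #x IN #B)) AND
     (ALL A : tset, #A IN tapp #F #n IMPLIES
        tpair #zero (tapp (tapp #P #n) #A) IN #le AND
        tpair (tapp (tapp #P #n) #A) #one IN #le) AND
     (tapp (tapp #P #n) (tapp #Om #n) EQ #one) AND
     (ALL A : tset, ALL B : tset, ALL C : tset,
        #A IN tapp #F #n IMPLIES #B IN tapp #F #n IMPLIES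
        #C IN tapp #F #n IMPLIES
        (ALL x : treal, #x IN #A IMPLIES #x IN #B IMPLIES ffalse _) IMPLIES
        (ALL x : treal, #x IN #C IFF (#x IN #A OR #x IN #B)) IMPLIES
        (tapp (tapp #P #n) #C EQ
         tapp #add (tpair (tapp (tapp #P #n) #A) (tapp (tapp #P #n) #B)))))).

Definition full_formula := abs (l := [:: tpow tnat]) (c := [::])
  (fun S => ALL k : tnat, #k IN #S).

Definition cover_formula := abs
  (l := [:: tnat; tpow tnat; tpow tnat]) (c := [::])
  (fun a S T => ALL k : tnat, #k IN #T IMPLIES #k IN #S OR #k EQ #a).

Definition image_formula := abs
  (l := [:: tpow tnat; tarr tnat tnat; tpow tnat]) (c := [::])
  (fun S g T => ALL k : tnat, #k IN #S IMPLIES tapp #g #k IN #T).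

(** The conclusion of [half_approx] for every [n] in a given set. *)
Definition approx_formula := abs
  (l := [:: tpow tnat; tarr tnat tfamily;
    tarr tnat tfamily; tarr tnat tmeasure; treal; trelation;
    toperation]) (c := [::])
  (fun good F G P d le add => ALL n : tnat, #n IN #good IMPLIES
    ALL A : tset, #A IN tapp #F #n IMPLIES
    EX C : tset, EX D : tset,
      #C IN tapp #G #n AND #D IN tapp #G #n AND
      (ALL x : treal, #x IN #C IMPLIES #x IN #A) AND
      (ALL x : treal, #x IN #A IMPLIES #x IN #D) AND
      tpair (tapp (tapp #P #n) #A)
        (tapp #add (tpair (tapp (tapp #P #n) #C) #d)) IN #le AND
      tpair (tapp (tapp #P #n) #D)
        (tapp #add (tpair (tapp (tapp #P #n) #A) #d)) IN #le).

(** The conclusion of [lower_half_not_approx] for every [n] in a given set. *)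
Definition not_approx_formula := abs
  (l := [:: tpow tnat; tarr tnat tfamily;
    tarr tnat tfamily; tarr tnat tmeasure; treal; treal; trelation])
  (c := [::])
  (fun good F G P zero half le => ALL n : tnat, #n IN #good IMPLIES
    EX A : tset, #A IN tapp #F #n AND
      tpair #half (tapp (tapp #P #n) #A) IN #le AND
      ALL D : tset, #D IN tapp #G #n IMPLIES
      (ALL x : treal, #x IN #D IMPLIES #x IN #A) IMPLIES
      ALL C : tset, #C IN tapp #F #n IMPLIES
      (ALL x : treal, #x IN #C IMPLIES #x IN #D) IMPLIES
      tpair (tapp (tapp #P #n) #C) #zero IN #le).

Section Factorial.
Context {R : realType} (U : nonstandard_extension R).
Let le : set (R * R) := [set p | p.1 <= p.2].
Let add : R * R -> R := fun p => p.1 + p.2.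

Definition mem_star (N : U tnat) (S : set nat) :=
  mem_in U N (star U (t := tpow tnat) S).

Lemma internal_space_at (N : U tnat) (S : set nat)
    (F : nat -> set (set R)) : mem_star N S ->
  (forall n, S n -> (0 < n)%N /\ set_algebra (grid n) (F n)) ->
  is_internal_probability_space (InternalSpace
    (hmap U tnat tset grid N)
    (hmap U tnat tfamily F N)
    (hmap U tnat tmeasure uniform N)).
Proof.
move=> NS algF.
have h := transferred U space_formula
  (add, (le, (1, (0, (uniform, (F, (grid, (S, tt)))))))).
have {h}[|sub [Om [compl [union [unit [one plus]]]]]] := h _ N NS.
  move=> n Sn /=; rewrite /le /add /=.
  have [n0 [sub Om compl union]] := algF _ Sn.
  split; first by [].
  split; first by [].
  split; first by move=> A FA; exists (grid n `\` A); split; [exact: compl|].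
  split; first by move=> A B FA FB; exists (A `|` B); split; [exact: union|].
  split.
    move=> A /sub AD; split; first exact: uniform_ge0.
    by rewrite -(uniform_grid n0); exact: uniform_le.
  split; first exact: uniform_grid.
  move=> A B C _ _ _ AB CE.
  rewrite -uniform_setU; last by rewrite -subset0 => x [] /AB.
  by congr uniform; apply/seteqP; split=> x /CE.
split; last 2 first.
- exact: one.
- move=> A B C FA FB FC AB CE; apply: plus FA FB FC _ _.
    by move=> x Ax Bx; have : (ext A `&` ext B) x by []; rewrite AB.
  by move=> x; split; rewrite -[mem_in U x C]/(ext C x) CE.
- split=> //.
  + move=> A /compl[C [FC CE]]; exists C => //.
    by apply/seteqP; split=> x; case: (CE x).
  + move=> A B FA FB; have [C [FC CE]] := union _ _ FA FB; exists C => //.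
    by apply/seteqP; split=> x; case: (CE x).
- exact: unit.
Qed.

(** For [n = 2 * m] with [m >= 2] the middle block lies in the grid; 2/n is the
    error made in [half_approx]. *)
Definition fine_double (e : R) : set nat :=
  [set n | exists2 m, n = m.*2 & (2 <= m)%N /\ 2 / n%:R <= e].

(** By transfer, an element of the extension of [S `|` [set n0]] either is the
    standard number [n0] or lies in the extension of [S]. *)
Lemma mem_star_cofinite (K : U tnat) (S : set nat) n0 :
  (forall n : nat, K <> star U (t := tnat) n) ->
  (forall k, (n0 <= k)%N -> S k) -> mem_star K S.
Proof.
move=> K_inf; elim: n0 S => [|n0 IH] S Sk.
  exact: (transferred U full_formula (S, tt) (fun k => Sk k isT) K).
have KS : mem_star K (S `|` [set n0]).
  apply: IH => k; rewrite leq_eqVlt => /predU1P[<-|/Sk]; [by right|by left].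
by have [|/K_inf] := transferred U cover_formula
  (S `|` [set n0], (S, (n0, tt))) (fun k Sk' => Sk') K KS.
Qed.

Lemma mem_star_factorial (K : U tnat) (e : R) : 0 < e ->
  (forall n : nat, K <> star U (t := tnat) n) ->
  mem_star (hmap U tnat tnat factorial K) (fine_double e).
Proof.
move=> e0 K_inf.
pose S := [set k | fine_double e k`!].
have KS : mem_star K S.
  apply: (@mem_star_cofinite _ _ (4 + Num.bound (2 / e))) => // k k_ge.
  have k_le : (k <= k`!)%N by exact: fact_geq.
  have k0 : 0 < k`!%:R :> R by rewrite ltr0n fact_gt0.
  have keven : (2 %| k`!)%N by apply: dvdn_fact; lia.
  exists (k`!./2).
    by rewrite -[LHS]odd_double_half -[odd _]negbK -dvdn2 keven.
  split.
    by rewrite -[2%N]/(4./2) half_leq//; apply: leq_trans k_le; lia.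
  rewrite ler_pdivrMr// mulrC -ler_pdivrMr//.
  apply: le_trans (ltW (archi_boundP _)) _; first by rewrite divr_ge0// ltW.
  rewrite ler_nat; apply: leq_trans k_le; apply: leq_trans k_ge.
  exact: leq_addl.
exact: (transferred U image_formula (fine_double e, (factorial, (S, tt)))
  (fun k Sk => Sk) K KS).
Qed.

End Factorial.

Theorem mainTheorem1 (R : realType) (U : nonstandard_extension R)
    (K : U tnat) (K_infinite : forall n : nat, K <> star U (t := tnat) n) :
  let N := hmap U tnat tnat factorial K in
  let Omega := hmap U tnat (tpow treal) grid N in
  let P := hmap U tnat (tarr (tpow treal) treal) uniform N in
  let F := hmap U tnat (tpow (tpow treal)) half_algebra N in
  let G := hmap U tnat (tpow (tpow treal)) three_block_algebra N in
  let MM := InternalSpace Omega F P in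
  let NN := InternalSpace Omega G P in
  [/\ is_internal_probability_space MM,
      is_internal_probability_space NN,
      loeb_extends NN MM &
      ~ exists2 NN', internal_subspace NN' NN & loeb_equivalent MM NN'].
Proof.
move=> N Omega P F G MM NN.
have N_fine (e : R) : 0 < e -> mem_star N (fine_double e).
  by move=> e0; exact: mem_star_factorial.
pose le : set (R * R) := [set p | p.1 <= p.2].
pose add (p : R * R) := p.1 + p.2.
have prob_MM : is_internal_probability_space MM.
  apply: (internal_space_at (N_fine 1 ltr01)) => _ [m -> [m2 _]].
  by split; [lia|exact: set_algebra_half].
have prob_NN : is_internal_probability_space NN.
  apply: (internal_space_at (N_fine 1 ltr01)) => _ [m -> [m2 _]].
  by split; [lia|exact: set_algebra_three_block].
split=> //.
- apply: loeb_extends_approx => // e e0 A FA.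
  have h := transferred U approx_formula (add, (le, (e, (uniform,
    (three_block_algebra, (half_algebra, (fine_double e, tt))))))).
  have {h}[|C [D [GC [GD [CA [AD PCD]]]]]] := h _ N (N_fine e e0) A FA.
    move=> n /= [m -> [m2 em]] B HB.
    have [C [D [GC GD CB BD [BC DB]]]] := half_approx m2 em HB.
    by exists C, D.
  by exists C, D.
have h := transferred U not_approx_formula
  (le, (2^-1 : R, (0 : R, (uniform,
  (three_block_algebra, (half_algebra, (fine_double (1 : R), tt))))))).
have {h}[|A [FA [A_half notin]]] := h _ N (N_fine 1 ltr01).
  move=> n /= [m -> [m2 _]].
  have [A [HA A_half HG]] := @lower_half_not_approx R _ m2.
  by exists A.
apply: (@not_loeb_equivalent_subspace _ _ _ MM NN A) => //.
apply: (@lt_le_trans _ _ 2^-1); first by rewrite invr_gt0.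
rewrite -[leLHS](st_hreal U); apply: st_le => //.
  by apply: in_hunit_hreal; lra.
exact: in_hunit_mu.
Qed.
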